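(* Let $\mathcal{D},\mathcal{D}'$ be division rings with $|\mathcal{D}|\neq 2$ and $|\mathcal{D}'|\neq 2$, and let $m,n,p,q$ be integers $\ge 2$. If $\varphi:M_{m\times n}(\mathcal{D})\to M_{p\times q}(\mathcal{D}')$ is a surjection such that for all $A,B\in M_{m\times n}(\mathcal{D})$, $$\operatorname{rank}(A-B)=\min\{m,n\}\iff \operatorname{rank}(A^{\varphi}-B^{\varphi})=\min\{p,q\},$$ then $\varphi$ is bijective, both $\varphi$ and $\varphi^{-1}$ preserve adjacency of matrices (two matrices $A,B$ of the same size being adjacent iff $\operatorname{rank}(A-B)=1$), and $\min\{m,n\}=\min\{p,q\}$.
   Context: $M_{m\times n}(\mathcal{D})$ is the set of $m\times n$ matrices with entries in $\mathcal{D}$. Rank means left row rank (dimension of the span of the rows in the left vector space over the division ring), which equals the right column rank. $A^{\varphi}$ denotes the image of $A$ under $\varphi$. *)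

(* Defs.v *)
From mathcomp Require Import all_boot all_order all_algebra.
From mathcomp Require Import boolp classical_sets functions cardinality.

Set Implicit Arguments.
Unset Strict Implicit.
Unset Printing Implicit Defensive.

Import GRing.Theory.
Local Open Scope ring_scope.
Local Open Scope classical_set_scope.

(* Despite its name, [GRing.field_axiom] (every x != 0 is a two-sided unit)
   does not involve commutativity; a [unitRingType] is moreover nontrivial. *)
Definition division_ring (D : unitRingType) : Prop := GRing.field_axiom D.

(* MathComp's [span], [free], [\dim] and [\rank] require a commutative field of
   scalars, hence the following versions for left modules over any ring. *)
Definition left_span (D : nzRingType) (V : lmodType D) (r : nat)
    (v : 'I_r -> V) : set V :=
  [set u | exists c : 'I_r -> D, u = \sum_(i < r) c i *: v i].

Definition left_free (D : nzRingType) (V : lmodType D) (r : nat)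
    (v : 'I_r -> V) : Prop :=
  forall c : 'I_r -> D, \sum_(i < r) c i *: v i = 0 -> forall i, c i = 0.

Definition has_left_dim (D : nzRingType) (V : lmodType D) (W : set V)
    (r : nat) : Prop :=
  exists b : 'I_r -> V, left_free b /\ left_span b = W.

(* Over a division ring, exactly one r satisfies [has_left_dim] below, so the
   default value 0 of [xget] plays no role. *)
Definition left_row_rank (D : nzRingType) (m n : nat) (A : 'M[D]_(m, n)) : nat :=
  xget 0%N [set r | has_left_dim (left_span (fun i : 'I_m => row i A)) r].

Definition adjacent (D : nzRingType) (m n : nat) (A B : 'M[D]_(m, n)) : Prop :=
  left_row_rank (A - B) = 1%N.

Definition preserves_adjacency (D D' : nzRingType) (m n p q : nat)
    (f : 'M[D]_(m, n) -> 'M[D']_(p, q)) : Prop :=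
  forall A B, adjacent A B -> adjacent (f A) (f B).

(* Main.v *)
Require Import Defs.
From mathcomp Require Import all_boot all_order all_algebra.
From mathcomp Require Import boolp classical_sets functions cardinality.

(** Call a matrix full if its rank is the minimum of its dimensions. Adjacency is
expressible by fullness of differences: distinct A, B are adjacent iff there is a
third matrix P such that X - P full implies X - A or X - B full. For m <= n,
fullness means that c X = 0 only for the row c = 0.
If A - B = u v, take P = A - u t v with t different from 0 and 1: if c and d,
scaled so that c u = d u = 1, annihilate X - A and X - B, then (1 - t) c + t d
annihilates X - P and is nonzero, its product with u being 1.
If A - B has rank at least 2, there are independent rows c, d such that c (A - P)
and d (B - P) are independent, and an injective X - P that agrees with A - P on c
and with B - P on d.
The case n <= m follows by transposing over the opposite ring. The equality of the
minima holds because adjacency-preserving maps do not increase rank (A - B). *)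

Set Implicit Arguments.
Unset Strict Implicit.
Unset Printing Implicit Defensive.

Import GRing.Theory.
Local Open Scope ring_scope.
Local Open Scope classical_set_scope.

(** * Row-injective matrices and their completion to invertible matrices *)

Definition row_injective (D : nzRingType) (m n : nat) (A : 'M[D]_(m, n)) : Prop :=
  forall c : 'rV[D]_m, c *m A = 0 -> c = 0.

Lemma division_ring_converse (D : unitRingType) :
  division_ring D -> division_ring D^c.
Proof. by move=> divD x; apply: divD. Qed.

Lemma row_injective_left_free (D : nzRingType) (m n : nat) (A : 'M[D]_(m, n)) :
  row_injective A <-> left_free (fun i => row i A).
Proof.
split=> [injA c cA0 i | freeA c cA0].
  have c0 : \row_i c i = 0.
    by apply: injA; rewrite mulmx_sum_row -[RHS]cA0; apply: eq_bigr => j _; rewrite mxE.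
  by have := congr1 (fun u : 'rV_m => u 0 i) c0; rewrite !mxE.
apply/rowP=> i; rewrite mxE; apply: (freeA (fun i => c 0 i)).
by rewrite -mulmx_sum_row.
Qed.

Lemma left_spanP (D : nzRingType) (m n : nat) (A : 'M[D]_(m, n)) (u : 'rV[D]_n) :
  left_span (fun i => row i A) u <-> exists c : 'rV[D]_m, u = c *m A.
Proof.
split=> [[c ->] | [c ->]].
  by exists (\row_i c i); rewrite mulmx_sum_row; apply: eq_bigr => j _; rewrite mxE.
by exists (fun i => c 0 i); rewrite mulmx_sum_row.
Qed.

Lemma row_injective_right_inverse (D : nzRingType) (m n : nat)
    (A : 'M[D]_(m, n)) (A' : 'M[D]_(n, m)) :
  A *m A' = 1%:M -> row_injective A.
Proof. by move=> AA' c cA0; rewrite -[c]mulmx1 -AA' mulmxA cA0 mul0mx. Qed.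

Lemma row_injectiveM (D : nzRingType) (m n p : nat)
    (A : 'M[D]_(m, n)) (B : 'M[D]_(n, p)) :
  row_injective A -> row_injective B -> row_injective (A *m B).
Proof. by move=> injA injB c; rewrite mulmxA => /injB/injA. Qed.

(** A column permutation brings a nonzero entry to the front, and a row with invertible first entry
    tops an invertible block triangular matrix. Both inverse equations are stated because one-sided
    inverses of square matrices become two-sided only as a consequence of completion. *)
Lemma nonzero_row_completion (D : unitRingType) (n : nat) (c : 'rV[D]_n.+1) :
  division_ring D -> c != 0 ->
  exists G G' : 'M[D]_n.+1, [/\ G *m G' = 1%:M, G' *m G = 1%:M & c = delta_mx 0 0 *m G].
Proof.
move=> divD cN0.
have [j cjN0] : exists j, c 0 j != 0.
  apply: contrapT => c0; move/eqP: cN0; apply; apply/rowP=> j; rewrite mxE.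
  by apply/eqP/negPn/negP => cj; apply: c0; exists j.
have ua := divD _ cjN0; set T : 'M[D]_(1 + n) := tperm_mx 0 j.
have TT : T *m T = 1%:M by rewrite -perm_mxM perm.tperm2 perm_mx1.
pose d : 'rV[D]_(1 + n) := c *m T.
have d0 : lsubmx d = (c 0 j)%:M.
  rewrite [LHS]mx11_scalar /d -xcolE !mxE (_ : lshift n 0 = 0) ?perm.tpermL //.
  exact: val_inj.
pose a := c 0 j.
pose U : 'M[D]_(1 + n) := block_mx a%:M (rsubmx d) 0 1%:M.
pose U' : 'M[D]_(1 + n) := block_mx a^-1%:M (- (a^-1 *: rsubmx d)) 0 1%:M.
have UU' : U *m U' = 1%:M.
  rewrite mulmx_block !mul0mx !mulmx0 !mulmx1 !addr0 add0r !mul_scalar_mx.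
  by rewrite scale_scalar_mx mulrV // scalerN scalerA mulrV // scale1r addNr -scalar_mx_block.
have U'U : U' *m U = 1%:M.
  rewrite mulmx_block !mul0mx !mulmx0 !mulmx1 !addr0 add0r !mul_scalar_mx.
  by rewrite scale_scalar_mx mulVr // subrr -scalar_mx_block.
exists (U *m T), (T *m U'); split.
- by rewrite mulmxA -(mulmxA U) TT mulmx1.
- by rewrite mulmxA -(mulmxA T) U'U mulmx1.
rewrite -[LHS]mulmx1 -TT mulmxA -/d mulmxA; congr (_ *m T).
rewrite -rowE -[LHS]hsubmxK d0.
have -> : row 0 U = row (lshift n 0) U by congr row; apply: val_inj.
by rewrite /U block_mxEv rowKu row_id.
Qed.

(** Gaussian elimination by induction on the number of rows: an invertible column change turns the
    first row into the first unit row, and the lower right block that remains is again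
    row-injective. *)
Lemma row_completion (D : unitRingType) (divD : division_ring D) (r m : nat)
    (C : 'M[D]_(r, m)) :
  row_injective C -> (r <= m)%N /\
  exists G G' : 'M[D]_m, [/\ G *m G' = 1%:M, G' *m G = 1%:M & C = pid_mx r *m G].
Proof.
elim: r m C => [|r IHr] m C injC.
  by split=> //; exists 1%:M, 1%:M; rewrite !mulmx1; split=> //; apply/matrixP=> -[].
case: m C injC => [|m] C injC.
  have /injC/rowP/(_ 0)/eqP : (const_mx 1 : 'rV[D]_r.+1) *m C = 0.
    exact: thinmx0.
  by rewrite !mxE oner_eq0.
pose C1 : 'M[D]_(1 + r, 1 + m) := C.
have uN0 : usubmx C1 != 0.
  apply/negP => /eqP u0; pose e : 'rV[D]_(1 + r) := row_mx 1%:M 0.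
  have /injC e0 : e *m C = 0.
    by rewrite -[C]/(C1) -[C1]vsubmxK mul_row_col u0 mulmx0 mul0mx addr0.
  have := congr1 (fun u : 'rV[D]_(1 + r) => u 0 (lshift r 0)) e0.
  by rewrite row_mxEl !mxE eqxx => /eqP; rewrite oner_eq0.
have [G0 [G0' [G0K G0'K uE]]] : exists G0 G0' : 'M[D]_(1 + m),
    [/\ G0 *m G0' = 1%:M, G0' *m G0 = 1%:M & usubmx C1 = delta_mx 0 0 *m G0].
  exact: nonzero_row_completion.
pose E : 'M[D]_(r, 1 + m) := dsubmx C1 *m G0'.
pose w := lsubmx E; pose K := rsubmx E.
have CE : C1 *m G0' = block_mx 1%:M 0 w K.
  rewrite -[C1]vsubmxK mul_col_mx uE -(mulmxA _ G0) G0K mulmx1 block_mxEv.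
  congr col_mx; last by rewrite hsubmxK.
  apply/rowP=> i; rewrite !mxE; case: splitP => k; rewrite ?ord1 !mxE => ik.
    by rewrite (_ : i == 0) //; apply/eqP/val_inj.
  by rewrite (_ : i == 0 = false) //; apply/negbTE/eqP => /(congr1 val) /=; rewrite ik.
have injK : row_injective K.
  move=> c cK0.
  (* A relation [c] among the rows of [K] extends to the rows of [C1]: the coefficient [- (c *m w)]
     of the first row cancels the contribution of [w]. *)
  have z0 : (row_mx (- (c *m w)) c : 'rV_(1 + r)) *m C1 = 0.
    apply: (row_injective_right_inverse G0'K).
    by rewrite -mulmxA CE mul_row_block cK0 mulmx1 mulmx0 addr0 addNr row_mx0.
  have := congr1 (fun u : 'rV[D]_(1 + r) => rsubmx u) (injC _ z0).
  rewrite row_mxKr => ->.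
  by apply/rowP=> i; rewrite !mxE.
have [le_rm [H [H' [HK H'K KE]]]] := IHr _ _ injK; split=> //.
(* [z] is [w] padded with zeros, so that the first [r.+1] rows of [B] are those of [C1 *m G0']. *)
pose z : 'cV[D]_m := pid_mx r *m w.
pose B : 'M[D]_(1 + m) := block_mx 1%:M 0 z H.
pose B' : 'M[D]_(1 + m) := block_mx 1%:M 0 (- (H' *m z)) H'.
have BB' : B *m B' = 1%:M.
  rewrite mulmx_block !mul0mx !mulmx0 !mulmx1 !addr0 add0r.
  by rewrite mulmxN mulmxA HK mul1mx subrr -scalar_mx_block.
have B'B : B' *m B = 1%:M.
  rewrite mulmx_block !mul0mx !mulmx0 !mulmx1 !addr0 add0r.
  by rewrite H'K addNr -scalar_mx_block.
exists (B *m G0), (G0' *m B'); split.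
- by rewrite mulmxA -(mulmxA B) G0K mulmx1.
- by rewrite mulmxA -(mulmxA G0') B'B mulmx1.
have -> : (pid_mx r.+1 : 'M[D]_(r.+1, m.+1)) =
    (block_mx 1%:M 0 0 (pid_mx r) : 'M[D]_(1 + r, 1 + m)).
  apply/matrixP=> i j; rewrite !mxE; case: splitP => i' ->; rewrite !mxE;
    by case: splitP => j' ->; rewrite !mxE ?ord1.
have pidB : block_mx 1%:M 0 0 (pid_mx r) *m B = C1 *m G0'.
  rewrite mulmx_block !mul0mx !mulmx0 !mulmx1 !addr0 !add0r -KE CE.
  by rewrite /z mulmxA pid_mx_id // pid_mx_1 mul1mx.
by rewrite mulmxA pidB -mulmxA G0'K mulmx1.
Qed.

Lemma row_injective_inverse (D : unitRingType) (divD : division_ring D)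
    (r m : nat) (C : 'M[D]_(r, m)) :
  row_injective C -> exists C' : 'M[D]_(m, r), C *m C' = 1%:M.
Proof.
case/(row_completion divD)=> le_rm [G [G' [GK _ ->]]].
by exists (G' *m pid_mx r); rewrite mulmxA -(mulmxA _ G) GK mulmx1 pid_mx_id ?pid_mx_1.
Qed.

(** Completing the square row-injective matrix [A] adds no rows, so [A] is itself the invertible
    matrix [G]. *)
Lemma mulmx1C_division (D : unitRingType) (divD : division_ring D)
    (m : nat) (A B : 'M[D]_m) : A *m B = 1%:M -> B *m A = 1%:M.
Proof.
move=> AB1; have injA := row_injective_right_inverse AB1.
have [_ [G [G' [_ G'G]]]] := row_completion divD injA.
rewrite pid_mx_1 mul1mx => AG; rewrite -AG in G'G.
by rewrite (_ : B = G') // -[LHS]mul1mx -G'G -mulmxA AB1 mulmx1.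
Qed.

(** * Rank factorizations and transposition over the opposite ring *)

Lemma trmx_mul_converse (D : nzRingType) (m r n : nat)
    (L : 'M[D^c]_(m, r)) (R : 'M[D^c]_(r, n)) :
  ((L *m R)^T : 'M[D]_(n, m)) = (R^T : 'M[D]_(n, r)) *m (L^T : 'M[D]_(r, m)).
Proof. by apply/matrixP=> i j; rewrite !mxE; apply: eq_bigr => k _; rewrite !mxE. Qed.

(** The one-sided inverses say that the columns of [L] and the rows of [R] are independent. This
    form treats rows and columns alike, so it passes directly to the transpose over [D^c]. *)
Definition rank_factorization (D : nzRingType) (m n : nat) (A : 'M[D]_(m, n))
    (r : nat) : Prop :=
  exists (L : 'M[D]_(m, r)) (R : 'M[D]_(r, n)) (L' : 'M[D]_(r, m)) (R' : 'M[D]_(n, r)),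
    [/\ A = L *m R, L' *m L = 1%:M & R *m R' = 1%:M].

Lemma rank_factorization_tr (D : nzRingType) (m n : nat) (A : 'M[D]_(m, n)) (r : nat) :
  rank_factorization A r -> rank_factorization (A^T : 'M[D^c]_(n, m)) r.
Proof.
move=> [L [R [L' [R' [-> L'L RR']]]]].
exists (R^T : 'M[D^c]__), (L^T : 'M[D^c]__), (R'^T : 'M[D^c]__), (L'^T : 'M[D^c]__).
by rewrite -!trmx_mul_rev L'L RR' !trmx1.
Qed.

(** A nontrivial relation among the rows of [R] becomes, after a change of basis of the inner space,
    a zero first row, which is dropped together with the matching column of [L]. *)
Lemma shorten_factorization (D : unitRingType) (divD : division_ring D)
    (m r n : nat) (L : 'M[D]_(m, r.+1)) (R : 'M[D]_(r.+1, n)) :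
  ~ row_injective R ->
  exists (L2 : 'M[D]_(m, r)) (R2 : 'M[D]_(r, n)), L *m R = L2 *m R2.
Proof.
move=> /existsNP[c /not_implyP[cR0 /eqP cN0]].
have [G [G' [_ G'G cE]]] : exists G G' : 'M[D]_(1 + r),
    [/\ G *m G' = 1%:M, G' *m G = 1%:M & c = delta_mx 0 0 *m G].
  exact: nonzero_row_completion.
pose S : 'M[D]_(1 + r, n) := G *m R; pose K : 'M[D]_(m, 1 + r) := L *m G'.
have S0 : usubmx S = 0.
  rewrite -cR0 cE -mulmxA -[G *m R]/S -rowE; apply/rowP=> j.
  by rewrite mxE [RHS]mxE; congr (S _ j); apply: val_inj.
exists (rsubmx K), (dsubmx S).
transitivity (K *m S); first by rewrite /K /S mulmxA -(mulmxA L) G'G mulmx1.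
by rewrite -[K in LHS]hsubmxK -[S in LHS]vsubmxK mul_row_col S0 mulmx0 add0r.
Qed.

(** Starting from [1%:M *m A], the factors are shortened as long as the rows of [R] or the columns
    of [L] are dependent; the columns of [L] are treated as rows over [D^c]. *)
Lemma rank_factorization_exists (D : unitRingType) (divD : division_ring D)
    (m n : nat) (A : 'M[D]_(m, n)) :
  exists r, rank_factorization A r.
Proof.
suff: forall r (L : 'M[D]_(m, r)) (R : 'M[D]_(r, n)), A = L *m R ->
    exists r, rank_factorization A r.
  by move=> /(_ m 1%:M A); apply; rewrite mul1mx.
elim=> [|r IHr] L R AE.
  exists 0%N, L, R, 0, 0; split=> //; apply/matrixP=> -[] //.
have divDc := division_ring_converse divD.
have [injR|/(shorten_factorization divD L)[L2 [R2 LRE]]] := EM (row_injective R); last first.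
  by apply: (IHr L2 R2); rewrite AE.
have [injL|] := EM (row_injective (L^T : 'M[D^c]_(r.+1, m))); last first.
  move/(shorten_factorization divDc (R^T : 'M[D^c]_(n, r.+1))) => [R2 [L2 LRE]].
  apply: (IHr (L2^T : 'M[D]__) (R2^T : 'M[D]__)).
  by rewrite -trmx_mul_converse -LRE trmx_mul_converse !trmxK.
have [R' RR'] := row_injective_inverse divD injR.
have [L' LL'] := row_injective_inverse divDc injL.
exists r.+1, L, R, (L'^T : 'M[D]__), R'; split=> //.
by have := trmx_mul_converse (L^T : 'M[D^c]__) L'; rewrite LL' trmx1 trmxK => <-.
Qed.

(** Multiplying by [L'] and [R'] factors the identity of size [r] through size [s], which makes an
    [r] by [s] matrix row-injective. *)
Lemma rank_factorization_min (D : unitRingType) (divD : division_ring D)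
    (m n : nat) (A : 'M[D]_(m, n)) (r s : nat) (L : 'M[D]_(m, s)) (R : 'M[D]_(s, n)) :
  rank_factorization A r -> A = L *m R -> (r <= s)%N.
Proof.
move=> [L1 [R1 [L' [R' [AE L'L RR']]]]] ALR.
have LR1 : (L' *m L) *m (R *m R') = 1%:M.
  by rewrite mulmxA -(mulmxA L') -ALR AE mulmxA L'L mul1mx.
by have [] := row_completion divD (row_injective_right_inverse LR1).
Qed.

Lemma rank_factorization_unique (D : unitRingType) (divD : division_ring D)
    (m n : nat) (A : 'M[D]_(m, n)) (r s : nat) :
  rank_factorization A r -> rank_factorization A s -> r = s.
Proof.
move=> rA sA; apply/eqP; rewrite eqn_leq; apply/andP; split.
  by case: (sA) => L [R [_ [_ [AE _ _]]]]; apply: rank_factorization_min AE.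
by case: (rA) => L [R [_ [_ [AE _ _]]]]; apply: rank_factorization_min AE.
Qed.

(** * Left row rank through factorizations *)

(** A basis of the row space supplies the rows of [R], and the coordinates of the rows of [A] in it
    supply [L]. *)
Lemma has_left_dim_rowsP (D : unitRingType) (divD : division_ring D)
    (m n : nat) (A : 'M[D]_(m, n)) (r : nat) :
  has_left_dim (left_span (fun i => row i A)) r <-> rank_factorization A r.
Proof.
split=> [[b [freeb spanb]] | [L [R [L' [R' [AE L'L RR']]]]]].
  pose B := \matrix_i b i.
  have bE : b = (fun i => row i B) by apply: funext => i; rewrite rowK.
  rewrite bE in freeb spanb; move/row_injective_left_free: freeb => injB.
  have /choice[N NE] i : exists c : 'rV_r, row i A = c *m B.
    apply/left_spanP; rewrite spanb; apply/left_spanP.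
    by exists (delta_mx 0 i); rewrite rowE.
  have /choice[M ME] i : exists c : 'rV_m, row i B = c *m A.
    apply/left_spanP; rewrite -spanb; apply/left_spanP.
    by exists (delta_mx 0 i); rewrite rowE.
  have [B' BB'] := row_injective_inverse divD injB.
  have AE : A = (\matrix_i N i) *m B by apply/row_matrixP=> i; rewrite row_mul rowK.
  have BE : B = (\matrix_i M i) *m A.
    by apply/row_matrixP=> i; rewrite row_mul [X in _ = X *m _]rowK.
  exists (\matrix_i N i), B, (\matrix_i M i), B'; split=> //.
  (* Substituting [A] into the expression of [B] shows that the product of the two coordinate
     matrices fixes [B], which is then cancelled by [B']. *)
  by rewrite -BB' [in RHS]BE [in RHS]AE mulmxA -[RHS]mulmxA BB' mulmx1.
exists (fun i => row i R); split.
  by apply/row_injective_left_free/(row_injective_right_inverse RR').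
have RE : R = L' *m A by rewrite AE mulmxA L'L mul1mx.
apply/seteqP; split=> u /left_spanP[c ->]; apply/left_spanP.
  by exists (c *m L'); rewrite -mulmxA -RE.
by exists (c *m L); rewrite -mulmxA -AE.
Qed.

Lemma left_row_rankP (D : unitRingType) (divD : division_ring D)
    (m n : nat) (A : 'M[D]_(m, n)) (r : nat) :
  left_row_rank A = r <-> rank_factorization A r.
Proof.
have rankE s : rank_factorization A s -> left_row_rank A = s.
  move=> sA; apply: xget_subset1; first exact/has_left_dim_rowsP.
  move=> i j /(has_left_dim_rowsP divD) iA /(has_left_dim_rowsP divD) jA.
  exact: rank_factorization_unique iA jA.
split=> [<- | /rankE //]; have [s sA] := rank_factorization_exists divD A.
by rewrite (rankE s).
Qed.

(** This is the equality of left row rank and right column rank: right scalars over [D] are left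
    scalars over [D^c]. *)
Lemma left_row_rank_tr (D : unitRingType) (divD : division_ring D)
    (m n : nat) (A : 'M[D]_(m, n)) :
  left_row_rank (A^T : 'M[D^c]_(n, m)) = left_row_rank A.
Proof.
apply/(left_row_rankP (division_ring_converse divD))/rank_factorization_tr.
exact/left_row_rankP.
Qed.

(** At rank [m] the left factor is square, hence invertible, and the right factor is
    row-injective. *)
Lemma row_injectiveP (D : unitRingType) (divD : division_ring D)
    (m n : nat) (A : 'M[D]_(m, n)) :
  (m <= n)%N -> left_row_rank A = minn m n <-> row_injective A.
Proof.
move=> le_mn; rewrite (minn_idPl le_mn); split=> [/(left_row_rankP divD) | injA].
  move=> [L [R [L' [R' [-> /(mulmx1C_division divD) LL' RR']]]]].
  by apply: row_injectiveM; apply: row_injective_right_inverse; eassumption.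
apply/left_row_rankP => //; have [A' AA'] := row_injective_inverse divD injA.
by exists 1%:M, A, 1%:M, A'; rewrite !mul1mx.
Qed.

Lemma adjacentP (D : unitRingType) (divD : division_ring D)
    (m n : nat) (A B : 'M[D]_(m, n)) :
  adjacent A B <->
  A <> B /\ exists (u : 'cV[D]_m) (v : 'rV[D]_n), A - B = u *m v.
Proof.
split=> [/(left_row_rankP divD)[u [v [u' [v' [uvE u'u vv']]]]] | [AB [u [v uvE]]]].
  split; last by exists u, v.
  move=> AB; have : u' *m (A - B) *m v' = 1%:M.
    by rewrite uvE mulmxA u'u mul1mx vv'.
  rewrite AB subrr mulmx0 mul0mx => /matrixP/(_ 0 0)/eqP.
  by rewrite !mxE eq_sym oner_eq0.
apply/left_row_rankP => //.
have [r rA] := rank_factorization_exists divD (A - B).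
have := rank_factorization_min divD rA uvE; case: r rA => [|[|r]] // [L [R [_ [_ [E _ _]]]]].
case: AB; apply/eqP; rewrite -subr_eq0 E; apply/eqP/matrixP=> i j.
by rewrite !mxE big_ord0.
Qed.

(** * Rows on a line, independent rows and interpolation *)

Lemma mulmx_nonzero_row (D : nzRingType) (m n : nat) (A : 'M[D]_(m, n)) :
  A <> 0 -> exists c : 'rV[D]_m, c *m A <> 0.
Proof.
move=> AN0; apply: contrapT => /forallNP A0; apply: AN0.
by apply/row_matrixP=> i; rewrite row0 rowE; apply: contrapT (A0 (delta_mx 0 i)).
Qed.

Lemma rows_on_line (D : nzRingType) (m n : nat) (A : 'M[D]_(m, n)) (v : 'rV[D]_n) :
  (forall c : 'rV[D]_m, exists s : D, c *m A = s *: v) ->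
  exists u : 'cV[D]_m, A = u *m v.
Proof.
move=> lineA; have /choice[s sE] i : exists s, row i A = s *: v by rewrite rowE.
exists (\col_i s i); apply/row_matrixP=> i; rewrite sE row_mul.
by rewrite [row i _]mx11_scalar !mxE mul_scalar_mx.
Qed.

(* A vector on the line of [c] is a difference of two vectors off that line. *)
Lemma off_line_ind (D : unitRingType) (divD : division_ring D) (m : nat)
    (c : 'rV[D]_m) (P : 'rV[D]_m -> Prop) :
  (2 <= m)%N -> (forall x y, P x -> P y -> P (x - y)) ->
  (forall d, ~ (exists s, d = s *: c) -> P d) -> forall d, P d.
Proof.
move=> m2 PB Poff d; have [[s ds]|/Poff //] := EM (exists s, d = s *: c).
(* If every row lay on the line of [c], the identity of size [m] would factor through size 1,
   against [2 <= m]. *)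
have [f fc] : exists f, ~ exists s, f = s *: c.
  apply: contrapT => /forallNP all_c.
  have [u uE] : exists u : 'cV[D]_m, 1%:M = u *m c.
    by apply: rows_on_line => e; rewrite mulmx1; apply: contrapT (all_c e).
  have [] := row_completion divD (row_injective_right_inverse (esym uE)).
  by rewrite leqNgt m2.
rewrite -(addrK f d); apply: PB; apply: Poff => // -[s' E]; apply: fc.
by exists (s' - s); rewrite scalerBl -E -ds addrC addKr.
Qed.

Lemma row_injective_pair (D : unitRingType) (divD : division_ring D) (m : nat)
    (c d : 'rV[D]_m) :
  c <> 0 -> ~ (exists s, d = s *: c) -> row_injective (col_mx c d).
Proof.
move=> /eqP cN0 dc e; rewrite -[e]hsubmxK mul_row_col.
rewrite [lsubmx e]mx11_scalar [rsubmx e]mx11_scalar !mul_scalar_mx.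
set a := lsubmx e 0 0; set b := rsubmx e 0 0 => abE.
have b0 : b = 0.
  apply: contrapT => /eqP/divD ub; apply: dc; exists (- (b^-1 * a)).
  apply/eqP; rewrite scaleNr -addr_eq0 addrC -[d]scale1r -(mulVr ub) -!scalerA -scalerDr.
  by rewrite abE scaler0.
move: abE; rewrite b0 scale0r addr0 => ac0.
have -> : a = 0.
  apply: contrapT => /eqP/divD ua; move/eqP: cN0; apply.
  by rewrite -[c]scale1r -(mulVr ua) -scalerA ac0 scaler0.
by rewrite !raddf0 row_mx0.
Qed.

(** [C] and [E] are the first rows of invertible matrices [G] and [H]; the witness sends the rows of
    [G] to the first [m] rows of [H]. *)
Lemma row_injective_interpolation (D : unitRingType) (divD : division_ring D)
    (r m n : nat) (C : 'M[D]_(r, m)) (E : 'M[D]_(r, n)) :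
  (m <= n)%N -> row_injective C -> row_injective E ->
  exists X : 'M[D]_(m, n), row_injective X /\ C *m X = E.
Proof.
move=> le_mn /(row_completion divD)[le_rm [G [G' [GK G'K ->]]]].
move=> /(row_completion divD)[_ [H [H' [HK _ ->]]]].
exists (G' *m pid_mx m *m H); split; last first.
  by rewrite !mulmxA -(mulmxA _ G) GK mulmx1 mul_pid_mx (minn_idPl le_rm) (minn_idPr le_rm).
apply: (@row_injective_right_inverse _ _ _ _ (H' *m pid_mx m *m G)).
rewrite !mulmxA -(mulmxA _ H) HK mulmx1 -(mulmxA G') pid_mx_id // pid_mx_1 mulmx1.
exact: G'K.
Qed.

Lemma independent_images (D : unitRingType) (divD : division_ring D) (m n : nat)
    (A B : 'M[D]_(m, n)) :
  (2 <= m)%N -> A <> 0 -> B <> 0 ->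
  ~ (exists (u : 'cV[D]_m) (v : 'rV[D]_n), A - B = u *m v) ->
  exists c d : 'rV[D]_m,
    row_injective (col_mx c d) /\ row_injective (col_mx (c *m A) (d *m B)).
Proof.
move=> m2 AN0 BN0 rankAB; apply: contrapT => /forallNP noind; apply: rankAB.
(* Otherwise both images lie on the line of [c *m A], so [A - B] has rank at most 1. *)
have dep (c d : 'rV[D]_m) : c *m A <> 0 -> ~ (exists s, d = s *: c) ->
    exists s, d *m B = s *: (c *m A).
  move=> cA dc; apply: contrapT => dBcA; apply: (noind c); exists d; split.
    by apply: row_injective_pair => // c0; apply: cA; rewrite c0 mul0mx.
  exact: row_injective_pair.
(* If [c] is killed by [B] and [d] by [A], their sum keeps the nonzero images [c *m A] and
   [d *m B]. *)
have [c [cA cB]] : exists c : 'rV[D]_m, c *m A <> 0 /\ c *m B <> 0.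
  have [c cA] := mulmx_nonzero_row AN0; have [d dB] := mulmx_nonzero_row BN0.
  have [cB|cB] := EM (c *m B = 0); last by exists c.
  have [dA|dA] := EM (d *m A = 0); last by exists d.
  by exists (c + d); rewrite !mulmxDl cB dA addr0 add0r.
have Bline (d : 'rV[D]_m) : exists s, d *m B = s *: (c *m A).
  apply: (@off_line_ind _ divD _ c (fun d => exists s, d *m B = s *: (c *m A))) d => // [x y [s xs] [t yt]|d dc]; last exact: dep.
  by exists (s - t); rewrite mulmxBl xs yt scalerBl.
have Aline (d : 'rV[D]_m) : exists s, d *m A = s *: (c *m A).
  apply: (@off_line_ind _ divD _ c (fun d => exists s, d *m A = s *: (c *m A))) d => // [x y [s xs] [t yt]|d dc].
    by exists (s - t); rewrite mulmxBl xs yt scalerBl.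
  have [dA|dA] := EM (d *m A = 0); first by exists 0; rewrite scale0r.
  (* Exchanging the roles of [c] and [d] in [dep] puts [c *m B] on the line of [d *m A]. As [c *m B]
     is nonzero and on the line of [c *m A], the two lines coincide. *)
  have cd : ~ (exists s, c = s *: d).
    move=> [s cE]; apply: dc; exists s^-1.
    have sN0 : s != 0.
      by apply/eqP => s0; apply: cA; rewrite cE s0 scale0r mul0mx.
    by rewrite cE scalerA mulVr ?divD // scale1r.
  have [s cBE] := dep _ _ dA cd; have [t cBE'] := Bline c.
  have sN0 : s != 0 by apply/eqP => s0; apply: cB; rewrite cBE s0 scale0r.
  by exists (s^-1 * t); rewrite -scalerA -cBE' cBE scalerA mulVr ?divD // scale1r.
have [u uE] : exists u : 'cV[D]_m, A - B = u *m (c *m A).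
  apply: rows_on_line => d; have [s sE] := Aline d; have [t tE] := Bline d.
  by exists (s - t); rewrite mulmxBr sE tE scalerBl.
by exists u, (c *m A).
Qed.

(** * Separation and third points by row-injective differences *)

(** Interpolation gives a row-injective matrix agreeing with [B - A] on a row [c] where the latter
    is nonzero; adding [A] to it gives a difference with [B] that kills [c]. *)
Lemma row_injective_separates (D : unitRingType) (divD : division_ring D) (m n : nat)
    (A B : 'M[D]_(m, n)) :
  (m <= n)%N -> A <> B ->
  exists X, row_injective (X - A) /\ ~ row_injective (X - B).
Proof.
move=> le_mn AB.
have [c cBA] : exists c : 'rV[D]_m, c *m (B - A) <> 0.
  by apply: mulmx_nonzero_row => /eqP; rewrite subr_eq0 => /eqP/esym.
have inj1 k (e : 'rV[D]_k) : e <> 0 -> row_injective e.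
  move=> eN0 a; rewrite [a]mx11_scalar mul_scalar_mx => ae0.
  have -> : a 0 0 = 0; last by rewrite raddf0.
  apply: contrapT => /eqP/divD ua; apply: eN0.
  by rewrite -[e]scale1r -(mulVr ua) -scalerA ae0 scaler0.
have cN0 : c <> 0 by move=> c0; apply: cBA; rewrite c0 mul0mx.
have [X [injX cX]] := row_injective_interpolation divD le_mn (inj1 _ _ cN0) (inj1 _ _ cBA).
exists (X + A); rewrite addrK; split=> // /(_ c) inj; apply: cN0; apply: inj.
by rewrite -addrA -opprB mulmxBr cX subrr.
Qed.

Lemma third_point_on_line (D : unitRingType) (divD : division_ring D) (m n : nat)
    (A B : 'M[D]_(m, n)) (t : D) :
  t <> 0 -> t <> 1 -> rank_factorization (A - B) 1 ->
  exists P, [/\ P <> A, P <> B &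
    forall X, row_injective (X - P) -> row_injective (X - A) \/ row_injective (X - B)].
Proof.
move=> t0 t1 [u [v [u' [v' [uvE u'u vv']]]]].
have uv_eq0 s : u *m (s *: v) = 0 -> s = 0.
  move=> /(congr1 (fun M => u' *m M *m v')).
  rewrite !mulmxA u'u mul1mx mulmx0 mul0mx -scalemxAl vv' => /matrixP/(_ 0 0).
  by rewrite !mxE mulr1.
exists (A - u *m (t *: v)); split.
- by move=> /eqP; rewrite -subr_eq0 addrAC subrr add0r oppr_eq0 => /eqP/uv_eq0/t0.
- move=> /eqP; rewrite -subr_eq0 addrAC uvE -mulmxBr.
  rewrite -[v in v - _]scale1r -scalerBl => /eqP/uv_eq0/eqP.
  by rewrite subr_eq0 => /eqP/esym.
move=> X injP; apply: contrapT => /not_orP[].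
move=> /existsNP[c /not_implyP[cXA cN0]] /existsNP[d /not_implyP[dXB dN0]].
have XPA : X - (A - u *m (t *: v)) = X - A + u *m (t *: v) by rewrite opprB addrA addrAC.
have XPB : X - (A - u *m (t *: v)) = X - B + u *m ((t - 1) *: v).
  rewrite XPA scalerBl scale1r mulmxBr -uvE opprB.
  by rewrite (addrC (u *m (t *: v))) !addrA subrK.
(* A nonzero [e] killing [M] has [e *m u] nonzero, since otherwise it would also kill the
   row-injective [X - P], with [P] the third point; so it can be scaled. *)
have normalize (e : 'rV[D]_m) s M : X - (A - u *m (t *: v)) = M + u *m (s *: v) ->
    e *m M = 0 -> e <> 0 ->
    exists f : 'rV[D]_m, f *m u = 1%:M /\ f *m (X - (A - u *m (t *: v))) = s *: v.
  move=> XE eM eN0; pose a := (e *m u) 0 0.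
  have aE : e *m u = a%:M by rewrite [LHS]mx11_scalar.
  have ua : a \is a GRing.unit.
    apply: divD; apply/eqP=> a0; apply: eN0; apply: injP.
    by rewrite XE mulmxDr eM add0r mulmxA aE a0 raddf0 mul0mx.
  exists (a^-1 *: e); rewrite -scalemxAl aE scale_scalar_mx mulVr //; split=> //.
  by rewrite XE mulmxDr -scalemxAl eM scaler0 add0r mulmxA -scalemxAl aE
    scale_scalar_mx mulVr // mul1mx.
have [c1 [c1u c1X]] := normalize _ _ _ XPA cXA cN0.
have [d1 [d1u d1X]] := normalize _ _ _ XPB dXB dN0.
(* The images of [c1] and [d1] are [t *: v] and [(t - 1) *: v]. The combination vanishes because [t]
   commutes with [1 - t], even in a noncommutative ring. *)
have e0 : (1 - t) *: c1 + t *: d1 = 0.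
  apply: injP; rewrite mulmxDl -!scalemxAl c1X d1X !scalerA -scalerDl.
  by rewrite mulrBl mulrBr mul1r mulr1 addrA subrK subrr scale0r.
have := congr1 (fun M => (M *m u) 0 0) e0.
rewrite mulmxDl -!scalemxAl c1u d1u -scalerDl subrK scale1r mul0mx !mxE => /eqP.
by rewrite oner_eq0.
Qed.

Lemma no_third_point (D : unitRingType) (divD : division_ring D) (m n : nat)
    (A B P : 'M[D]_(m, n)) :
  (2 <= m)%N -> (m <= n)%N -> P <> A -> P <> B ->
  ~ (exists (u : 'cV[D]_m) (v : 'rV[D]_n), A - B = u *m v) ->
  exists X, [/\ row_injective (X - P), ~ row_injective (X - A) & ~ row_injective (X - B)].
Proof.
move=> m2 le_mn PA PB rankAB.
have AP : A - P <> 0 by move/eqP; rewrite subr_eq0 => /eqP/esym.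
have BP : B - P <> 0 by move/eqP; rewrite subr_eq0 => /eqP/esym.
have [|c [d [injcd injAB]]] := independent_images divD m2 AP BP.
  by rewrite opprB addrA subrK.
have [X [injX]] := row_injective_interpolation divD le_mn injcd injAB.
(* The shift by [P] makes [c] annihilate the difference with [A], because [c *m X = c *m (A - P)];
   likewise [d] and [B]. *)
rewrite mul_col_mx => /eq_col_mx[cX dX]; exists (X + P); rewrite addrK.
have notinj (e : 'rV[D]_m) M : e <> 0 -> e *m X = e *m (M - P) ->
    ~ row_injective (X + P - M).
  move=> eN0 eX /(_ e) inj; apply: eN0; apply: inj.
  by rewrite -addrA -[P - M]opprB mulmxBr eX subrr.
split=> //.
- apply: (notinj c) => // c0; have := injcd (row_mx 1%:M 0).
  rewrite mul_row_col c0 mulmx0 mul0mx addr0 => /(_ erefl).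
  rewrite -row_mx0 => /eq_row_mx[/matrixP/(_ 0 0)/eqP + _].
  by rewrite !mxE oner_eq0.
- apply: (notinj d) => // d0; have := injcd (row_mx 0 1%:M).
  rewrite mul_row_col d0 mulmx0 mul0mx addr0 => /(_ erefl).
  rewrite -row_mx0 => /eq_row_mx[_ /matrixP/(_ 0 0)/eqP].
  by rewrite !mxE oner_eq0.
Qed.

(** * Full rank for matrices of any shape, and adjacency expressed by it *)

Definition full_rank (D : nzRingType) (m n : nat) (A : 'M[D]_(m, n)) : Prop :=
  left_row_rank A = minn m n.

Lemma full_rank_tr (D : unitRingType) (divD : division_ring D) (m n : nat)
    (A : 'M[D]_(m, n)) :
  full_rank (A^T : 'M[D^c]_(n, m)) <-> full_rank A.
Proof. by rewrite /full_rank left_row_rank_tr // minnC. Qed.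

Lemma full_rank_separates (D : unitRingType) (divD : division_ring D) (m n : nat)
    (A B : 'M[D]_(m, n)) :
  A <> B -> exists X, full_rank (X - A) /\ ~ full_rank (X - B).
Proof.
(* The ring is generalized as well, because the tall case uses the wide one over [D^c]. *)
wlog le_mn : D divD m n A B / (m <= n)%N => [wide AB|/(row_injective_separates divD le_mn)].
  have [/wide|/ltnW le_nm] := leqP m n; first exact.
  have [|X] := wide _ (division_ring_converse divD) _ _ (A^T : 'M[D^c]__) B^T le_nm.
    by move=> /trmx_inj.
  rewrite -(trmxK X) -!raddfB => -[XA XB]; exists (X^T : 'M[D]__); split.
    by apply/full_rank_tr.
  by move/full_rank_tr => /(_ divD).
by move=> [X [XA XB]]; exists X; split; [|move/(row_injectiveP divD _ le_mn)];
  first exact/row_injectiveP.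
Qed.

(* The points of a line through [A] and [B] are recognized by full rank alone;
   a third point exists on the line since [D] has an element [t] besides 0, 1. *)
Lemma adjacent_full_rankP (D : unitRingType) (divD : division_ring D) (m n : nat)
    (t : D) (A B : 'M[D]_(m, n)) :
  t <> 0 -> t <> 1 -> (2 <= m)%N -> (2 <= n)%N ->
  adjacent A B <-> A <> B /\ exists P, [/\ P <> A, P <> B &
    forall X, full_rank (X - P) -> full_rank (X - A) \/ full_rank (X - B)].
Proof.
wlog le_mn : D divD m n t A B / (m <= n)%N => [wide|] t0 t1 m2 n2.
  have [le_mn|/ltnW le_nm] := leqP m n; first exact: (wide D divD m n t).
  have := wide _ (division_ring_converse divD) _ _ t (A^T : 'M[D^c]__) B^T le_nm t0 t1 n2 m2.
  rewrite /adjacent -raddfB left_row_rank_tr // => ->; split.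
    move=> [AB [P [PA PB PX]]]; split; first by move=> E; apply: AB; rewrite E.
    exists (P^T : 'M[D]__); split=> [E|E|X].
    - by apply: PA; rewrite -E trmxK.
    - by apply: PB; rewrite -E trmxK.
    have := PX (X^T : 'M[D^c]__); rewrite -{1}(trmxK P) -!raddfB.
    by move=> H /(full_rank_tr divD)/H[]/(full_rank_tr divD); [left|right].
  move=> [AB [P [PA PB PX]]]; split; first by move/trmx_inj.
  exists (P^T : 'M[D^c]__); split=> [/trmx_inj //|/trmx_inj //|X].
  rewrite -(trmxK X) -!raddfB => /(full_rank_tr divD)/PX[]XM; [left|right];
    exact/full_rank_tr.
split=> [adjAB|[AB [P [PA PB PX]]]].
  have [AB _] := (adjacentP divD A B).1 adjAB; split=> //.
  have [P [PA PB PX]] := third_point_on_line divD t0 t1 ((left_row_rankP divD _ _).1 adjAB).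
  exists P; split=> // X /(row_injectiveP divD _ le_mn)/PX[]/(row_injectiveP divD _ le_mn);
    by [left|right].
apply/adjacentP => //; split=> //; apply: contrapT.
move=> /(no_third_point divD m2 le_mn PA PB)[X [XP XA XB]].
have [] := PX X; first exact/row_injectiveP.
  by move/(row_injectiveP divD _ le_mn).
by move/(row_injectiveP divD _ le_mn).
Qed.

(** * A third scalar, and the effect of adjacency-preserving maps on rank *)

Lemma division_ring_third_element (D : nzRingType) :
  ~ ([set: D] #= `I_2)%card -> exists t : D, t <> 0 /\ t <> 1.
Proof.
move=> cardD; apply: contrapT => /forallNP no_t; apply: cardD.
have t01 (t : D) : t = 0 \/ t = 1.
  by apply: contrapT => /not_orP; apply: no_t.
apply/card_set_bijP; exists (fun t => if t == 0 then 0%N else 1%N); split.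
- by move=> t _ /=; case: ifP.
- move=> x y _ _; case: (t01 x) => ->; case: (t01 y) => ->;
    by rewrite ?eqxx ?oner_eq0.
- case=> [|[|//]] _; [by exists 0 => //=; rewrite eqxx | exists 1 => //=].
  by rewrite oner_eq0.
Qed.

(* Adjacency-preserving maps do not increase the arithmetic distance: a sum of
   [k] matrices of rank at most 1 is walked along in [k] steps. *)
Lemma preserves_adjacency_factorization (D D' : unitRingType)
    (divD : division_ring D) (divD' : division_ring D') (m n p q : nat)
    (f : 'M[D]_(m, n) -> 'M[D']_(p, q)) :
  preserves_adjacency f ->
  forall (k : nat) (L : 'M[D]_(m, k)) (R : 'M[D]_(k, n)) (C : 'M[D]_(m, n)),
  exists (L' : 'M[D']_(p, k)) (R' : 'M[D']_(k, q)), f (C + L *m R) - f C = L' *m R'.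
Proof.
move=> fadj; elim=> [|k IHk] L R C.
  exists 0, 0; rewrite mul0mx (_ : L *m R = 0) ?addr0 ?subrr //.
  by apply/matrixP=> i j; rewrite !mxE big_ord0.
pose L1 : 'M[D]_(m, 1 + k) := L; pose R1 : 'M[D]_(1 + k, n) := R.
pose C1 := C + lsubmx L1 *m usubmx R1.
have LRE : C + L *m R = C1 + rsubmx L1 *m dsubmx R1.
  by rewrite -addrA -mul_row_col hsubmxK vsubmxK.
have [L' [R' fE]] := IHk (rsubmx L1) (dsubmx R1) C1.
have [u [v uvE]] : exists (u : 'cV[D']_p) (v : 'rV[D']_q), f C1 - f C = u *m v.
  (* The outer product removed may vanish; then the walk stays in place and zero factors serve. *)
  have [->|C1C] := EM (C1 = C); first by exists 0, 0; rewrite subrr mul0mx.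
  have /fadj/(adjacentP divD')[_ //] : adjacent C1 C.
  by apply/adjacentP => //; split=> //; exists (lsubmx L1), (usubmx R1); rewrite addrC addKr.
have stepE : f (C + L *m R) - f C = row_mx u L' *m col_mx v R'.
  by rewrite mul_row_col -uvE -fE LRE [RHS]addrC addrA subrK.
by exists (row_mx u L'), (col_mx v R').
Qed.

(** The walk from [B] to [A] along a rank factorization of [A - B] factors the image difference
    through the same inner size. *)
Lemma preserves_adjacency_rank_le (D D' : unitRingType)
    (divD : division_ring D) (divD' : division_ring D') (m n p q : nat)
    (f : 'M[D]_(m, n) -> 'M[D']_(p, q)) (A B : 'M[D]_(m, n)) :
  preserves_adjacency f ->
  (left_row_rank (f A - f B) <= left_row_rank (A - B))%N.
Proof.
move=> fadj; have /(left_row_rankP divD)[L [R [_ [_ [ABE _ _]]]]] := erefl (left_row_rank (A - B)).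
have [L' [R']] := preserves_adjacency_factorization divD divD' fadj L R B.
rewrite -ABE (addrC B) subrK; apply: rank_factorization_min => //.
exact/left_row_rankP.
Qed.

(** * Transfer of adjacency and rank along the surjection *)

Unset Implicit Arguments.

Theorem theorem3p2 (D D' : unitRingType)
    (divD : division_ring D) (divD' : division_ring D')
    (cardD : ~ ([set: D] #= `I_2)%card) (cardD' : ~ ([set: D'] #= `I_2)%card)
    (m n p q : nat)
    (hm : (2 <= m)%N) (hn : (2 <= n)%N) (hp : (2 <= p)%N) (hq : (2 <= q)%N)
    (phi : 'M[D]_(m, n) -> 'M[D']_(p, q))
    (phi_surj : forall B : 'M[D']_(p, q), exists A : 'M[D]_(m, n), phi A = B)
    (phi_rank : forall A B : 'M[D]_(m, n),
      left_row_rank (A - B) = minn m n <->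
      left_row_rank (phi A - phi B) = minn p q) :
  (exists phi_inv : 'M[D']_(p, q) -> 'M[D]_(m, n),
    [/\ cancel phi phi_inv, cancel phi_inv phi,
        preserves_adjacency phi & preserves_adjacency phi_inv]) /\
  minn m n = minn p q.
Proof.
have phi_full A B : full_rank (A - B) <-> full_rank (phi A - phi B) by exact: phi_rank.
(* Points with the same image have full-rank differences with the same matrices [X], which
   separation forbids for distinct points. *)
have phi_inj : injective phi.
  move=> A B phiAB; apply: contrapT => /(full_rank_separates divD)[X [XA XB]].
  by apply: XB; apply/phi_full; rewrite -phiAB; apply/phi_full.
have [psi psiK] := choice phi_surj.
have phiK : cancel phi psi by move=> A; apply: phi_inj; rewrite psiK.
have [t [t0 t1]] := division_ring_third_element cardD.
have [t' [t'0 t'1]] := division_ring_third_element cardD'.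
(* The description of adjacency mentions only full rank, equality and quantification over all
   matrices, all of which the bijection [phi] transports in both directions. *)
have phi_adj A B : adjacent A B <-> adjacent (phi A) (phi B).
  rewrite (adjacent_full_rankP divD _ _ t0 t1) // (adjacent_full_rankP divD' _ _ t'0 t'1) //.
  split=> -[AB [P [PA PB PX]]].
    split; first by move/phi_inj.
    exists (phi P); split=> [/phi_inj //|/phi_inj //|X].
    by rewrite -(psiK X) => /phi_full/PX[]/phi_full; [left|right].
  split; first by move=> E; apply: AB; rewrite E.
  exists (psi P); split=> [E|E|X].
  - by apply: PA; rewrite -E psiK.
  - by apply: PB; rewrite -E psiK.
  by move=> /phi_full; rewrite psiK => /PX[]/phi_full; [left|right].
have phi_pres : preserves_adjacency phi by move=> A B /phi_adj.
have psi_pres : preserves_adjacency psi.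
  by move=> A B; rewrite -{1}(psiK A) -{1}(psiK B) => /phi_adj.
split; first by exists psi.
(* Separating 0 from the constant matrix 1 yields a full-rank matrix; the two differ because the
   matrices have at least one entry. *)
have [A A0] : exists A : 'M[D]_(m, n), left_row_rank (A - 0) = minn m n.
  have [|A [A0 _]] := @full_rank_separates D divD m n 0 (const_mx 1); last by exists A.
  move=> /matrixP/(_ (Ordinal (ltnW hm)) (Ordinal (ltnW hn)))/eqP.
  by rewrite !mxE eq_sym oner_eq0.
have phiA0 := (phi_rank A 0).1 A0.
apply/eqP; rewrite eqn_leq; apply/andP; split.
  (* The rank bound is applied to [psi] here and to [phi] for the opposite inequality. *)
  rewrite -A0 -phiA0 -{1}(phiK A) -{1}(phiK 0); exact: preserves_adjacency_rank_le.
by rewrite -A0 -phiA0; apply: preserves_adjacency_rank_le.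
Qed.
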